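(* Let $G$ be a finitely generated torsion-free nilpotent group of nilpotency class $c$ with $c\leq 2$, and let $H$ be a subgroup of finite index in $G$. Then there exist a subgroup $K$ of finite index in $H$ and a strongly simple epimorphism $f:K\rightarrow G$.
   Context: For a subgroup $K$ of finite index in $G$ and a homomorphism $f:K\to G$, a subgroup $U$ of $G$ is $f$-invariant if $U\leq K$ and $U^f\leq U$, where $U^f$ is the image of $U$ under $f$. The homomorphism $f$ is strongly simple if the only $f$-invariant subgroup of $G$ is the trivial subgroup. *)

(* Defs.v *)
From HB Require Import structures.
From mathcomp Require Import all_boot.
From mathcomp Require Import boolp classical_sets functions cardinality.

Set Implicit Arguments.
Unset Strict Implicit.
Unset Printing Implicit Defensive.

Local Open Scope group_scope.
Local Open Scope classical_set_scope.

(* Groups are the arbitrary, possibly infinite, [groupType];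
   subgroups are [Prop]-valued subsets of the carrier. *)

Definition subgroup (G : groupType) (A : set G) : Prop :=
  group_closed [in A].

Definition generated (G : groupType) (A : set G) : set G :=
  smallest (@subgroup G) A.

Definition finite_index (G : groupType) (K H : set G) : Prop :=
  [/\ subgroup K, K `<=` H &
      finite_set [set [set k * x | k in K] | x in H]].

Definition finitely_generated (G : groupType) : Prop :=
  exists2 S : set G, finite_set S & generated S = [set: G].

Definition torsion_free (G : groupType) : Prop :=
  forall (x : G) (n : nat), (0 < n)%N -> x ^+ n = 1 -> x = 1.

(* The indexing starts at 0: [lower_central G n] is the (n+1)-st term
   gamma_(n+1)(G) in the convention gamma_1(G) = G. *)
Unset Implicit Arguments.
Fixpoint lower_central (G : groupType) (n : nat) {struct n} : set G :=
  if n is m.+1 then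
    generated [set z | exists x y : G, lower_central G m x /\ z = [~ x, y]]
  else [set: G].
Set Implicit Arguments.

Definition nilpotent_of_class (G : groupType) (c : nat) : Prop :=
  lower_central G c = [set 1] /\
  forall m : nat, (m < c)%N -> lower_central G m <> [set 1].

(* A homomorphism K -> G is encoded by a total function on G that is
   multiplicative on K; its values outside K are irrelevant here and in
   the definitions below. *)
Definition morphism_on (G : groupType) (K : set G) (f : G -> G) : Prop :=
  {in K &, {morph f : x y / x * y}}.

Definition epimorphism_on (G : groupType) (K : set G) (f : G -> G) : Prop :=
  morphism_on K f /\ f @` K = [set: G].

Definition invariant_subgroup (G : groupType) (K : set G) (f : G -> G)
    (U : set G) : Prop :=
  [/\ subgroup U, U `<=` K & f @` U `<=` U].

Definition strongly_simple (G : groupType) (K : set G) (f : G -> G) : Prop :=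
  forall U : set G, invariant_subgroup K f U -> U = [set 1].

(* Main.v *)
Require Import Defs.
From HB Require Import structures.
From mathcomp Require Import all_boot.
From mathcomp Require Import ssralg ssrnum ssrint intdiv.
From mathcomp Require Import boolp classical_sets functions cardinality.

Set Implicit Arguments.
Unset Strict Implicit.
Unset Printing Implicit Defensive.
Import GRing.Theory.

Local Open Scope group_scope.
Local Open Scope classical_set_scope.

(* The inverse of [f] is a dilation [phi], an injective endomorphism of [G]
   with [phi x = x ^+ n] modulo the centre and [phi z = z ^+ (n * n)] for [z]
   central.  Since [(x * y) ^+ n = x ^+ n * y ^+ n * [~ y, x] ^+ 'C(n, 2)], one
   can take [phi x = x ^+ n * e x ^+ t] as soon as [e] is a central-valued map
   with [e (x * y) = e x * e y * [~ x, y] ^+ M], [e z = z ^+ (2 * M)] on the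
   centre and [M * t = 'C(n, 2)].  Such an [e], for some [M > 0], is built by
   extending it from the centre to [G] one generator at a time, [M] being
   multiplied at each step by some [p > 0] such that the [p]-th power of the new
   generator lies in the preceding subgroup, if there is one.  For [n] a suitable multiple
   of an [N] with [x ^+ N] in [H] for all [x], the image [K] of [phi] lies in
   [H]; it contains all [n ^ 3]-th powers, hence has finite index.  An invariant
   subgroup is contained in the image of every iterate of [phi], which is
   trivial because [G] has no infinitely divisible element. *)

(** * Subgroups as sets *)

Lemma subgroupP (G : groupType) (A : set G) :
  subgroup A <-> A 1 /\ forall x y, A x -> A y -> A (x / y).
Proof.
rewrite /subgroup /group_closed /divg_closed; split => -[A1 AB]; split.
- by move: A1; rewrite inE.
- move=> x y Ax Ay; have := AB x y; rewrite !inE; exact.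
- by rewrite inE.
- by move=> x y; rewrite !inE; apply: AB.
Qed.

Section Subgroup.
Variables (G : groupType) (A : set G).
Hypothesis sA : subgroup A.

Lemma subgroup1 : A 1. Proof. by case/subgroupP: sA. Qed.

Lemma subgroupF x y : A x -> A y -> A (x / y).
Proof. by case/subgroupP: sA => _; apply. Qed.

Lemma subgroupV x : A x -> A x^-1.
Proof. by move=> Ax; rewrite -(mul1g x^-1); apply/subgroupF/Ax/subgroup1. Qed.

Lemma subgroupM x y : A x -> A y -> A (x * y).
Proof. by move=> Ax Ay; rewrite -(invgK y); apply/subgroupF/subgroupV. Qed.

Lemma subgroupX x n : A x -> A (x ^+ n).
Proof.
move=> Ax; elim: n => [|n IH]; first exact: subgroup1.
by rewrite expgS; apply: subgroupM.
Qed.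
End Subgroup.

Lemma sub_generated (G : groupType) (S A : set G) :
  subgroup A -> S `<=` A -> generated S `<=` A.
Proof. exact: smallest_sub. Qed.

(** * Integer powers, and adjoining an element to a subgroup *)

Section IntPower.
Variable G : groupType.
Implicit Types (x y : G) (i j : int).

Definition expz x i : G :=
  match i with Posz n => x ^+ n | Negz n => x ^- n.+1 end.

Lemma expz1S x i : expz x (i + 1)%R = expz x i * x.
Proof.
case: i => [n|[|n]].
- by rewrite -PoszD addn1 /= expgSr.
- by rewrite /= mulVg.
- have -> : (Negz n.+1 + 1)%R = Negz n by rewrite !NegzE -addn1 PoszD opprD addrNK.
  by rewrite /= (expgS x n.+1) invgM mulgVK.
Qed.

Lemma expzD x i j : expz x (i + j)%R = expz x i * expz x j.
Proof.
elim/int_rect: j => [|n IH|n IH]; first by rewrite addr0 mulg1.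
- by rewrite -addn1 PoszD addrA !expz1S IH mulgA.
- apply: (mulIg x); rewrite -mulgA -!expz1S -addrA.
  by rewrite -[in n.+1]addn1 PoszD opprD subrK IH.
Qed.

Lemma expzN x i : expz x (- i)%R = (expz x i)^-1.
Proof. by apply: (mulIg (expz x i)); rewrite -expzD addNr mulVg. Qed.

Lemma expzM x i j : expz x (i * j)%R = expz (expz x i) j.
Proof.
elim/int_rect: j => [|n IH|n IH]; first by rewrite mulr0.
- rewrite -addn1 PoszD mulrDr mulr1 expz1S -IH. by rewrite expzD.
- apply: (mulIg (expz x i)); rewrite -expz1S -[in LHS](mulr1 i) -expzD.
  rewrite mulr1 -[X in (_ * _ + X)%R](mulr1 i) -mulrDr.
  by rewrite -addn1 PoszD opprD subrK IH.
Qed.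

Lemma subgroup_expz (A : set G) x i : subgroup A -> A x -> A (expz x i).
Proof.
move=> sA Ax; case: i => n /=; first exact: subgroupX.
by apply: subgroupV => //; apply: subgroupX.
Qed.

(** All integer powers are quantified over: in an infinite group, conjugation by [x] may map [A]
    into itself without its inverse doing so. *)
Definition normalizes (A : set G) x := forall a i, A a -> A (a ^ expz x i).

Definition adjoin (A : set G) x : set G :=
  [set y | exists a i, A a /\ y = a * expz x i].

Lemma sub_adjoin A x : A `<=` adjoin A x.
Proof. by move=> a Aa; exists a, 0%R; rewrite mulg1. Qed.

Lemma mem_adjoin A x : subgroup A -> adjoin A x x.
Proof. by move=> sA; exists 1, 1%R; rewrite mul1g; split=> //; apply: subgroup1. Qed.

Lemma adjoin_mul x a b i j : (a * expz x i) * (b * expz x j) =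
  (a * b ^ expz x (- i)%R) * expz x (i + j)%R.
Proof. by rewrite /conjg expzN invgK expzD !mulgA mulgVK. Qed.

Lemma subgroup_adjoin A x : subgroup A -> normalizes A x -> subgroup (adjoin A x).
Proof.
move=> sA nA; apply/subgroupP; split; first by apply: sub_adjoin; apply: subgroup1.
move=> _ _ [a [i [Aa ->]]] [b [j [Ab ->]]].
exists (a * (b^-1) ^ expz x (j - i)%R), (i - j)%R; split.
  by apply: subgroupM => //; apply: nA; apply: subgroupV.
by rewrite /conjg !(expzD, expzN, invgM, invgK) !mulgA mulgVK mulgK.
Qed.

Lemma adjoin_exp A x a i n : subgroup A -> normalizes A x -> A a ->
  exists2 b, A b & (a * expz x i) ^+ n = b * expz x (i * n%:Z)%R.
Proof.
move=> sA nA Aa; elim: n => [|n [b Ab IH]].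
  by exists 1; [exact: subgroup1 | rewrite mulr0 mulg1].
exists (a * b ^ expz x (- i)%R); first by apply: subgroupM => //; apply: nA.
by rewrite expgS IH adjoin_mul -[in RHS]addn1 PoszD mulrDr mulr1 addrC.
Qed.

End IntPower.

(** * Groups of class at most two *)

Definition class_le2 (G : groupType) := forall x y z : G, commute [~ x, y] z.

Lemma nilpotent_class_le2 (G : groupType) c :
  nilpotent_of_class G c -> (c <= 2)%N -> class_le2 G.
Proof.
case=> + _; case: c => [|[|[|//]]] L _ x y z.
- have E w : w = 1 :> G by have : lower_central G 0 w by []; rewrite L.
  by rewrite /commute (E (_ * z)) (E (z * _)).
- have -> : [~ x, y] = 1.
    suff : lower_central G 1 [~ x, y] by rewrite L.
    by apply: sub_gen_smallest; exists x, y.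
  exact/commute_sym/commute1.
- apply/commgP/eqP; suff : lower_central G 2 [~ [~ x, y], z] by rewrite L.
  apply: sub_gen_smallest; exists [~ x, y], z; split=> //.
  by apply: sub_gen_smallest; exists x, y.
Qed.

Section ClassTwo.
Variable G : groupType.
Hypothesis nil2 : class_le2 G.
Implicit Types x y z : G.

Lemma commMg x y z : [~ x * y, z] = [~ x, z] * [~ y, z].
Proof.
apply: (mulgI (z * (x * y))); rewrite -commgC.
rewrite -[LHS]mulgA (commgC y z) !mulgA (commgC x z).
by rewrite -(mulgA (z * x)) nil2 !mulgA.
Qed.

Lemma commgM x y z : [~ x, y * z] = [~ x, y] * [~ x, z].
Proof. by rewrite -invgR commMg invgM !invgR nil2. Qed.

Lemma commVg x y : [~ x^-1, y] = [~ x, y]^-1.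
Proof. by apply: (mulgI [~ x, y]); rewrite -commMg !mulgV comm1g. Qed.

Lemma commXg x y n : [~ x ^+ n, y] = [~ x, y] ^+ n.
Proof. by elim: n => [|n IH]; rewrite ?comm1g // !expgS commMg IH. Qed.

Lemma conjg_comm x y : x ^ y = x * [~ x, y].
Proof. by rewrite commgEl mulVKg. Qed.

(** The commutator is multiplicative in each argument, so one passes from generators to all elements
    one argument at a time. *)
Lemma comm_sub_generated (S A : set G) : generated S = [set: G] ->
  subgroup A -> (forall x y, S x -> S y -> A [~ x, y]) -> forall x y, A [~ x, y].
Proof.
move=> genS sA AS.
have sgl y : subgroup [set x | A [~ x, y]].
  apply/subgroupP; split => /=; first by rewrite comm1g; exact: (subgroup1 sA).
  by move=> x z Ax Az; rewrite commMg commVg; apply: (subgroupF sA).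
have AG x y : S y -> A [~ x, y].
  move=> Sy; have : [set: G] x by []; rewrite -genS.
  by apply: (sub_generated (sgl y)) => {}x Sx; apply: AS.
move=> x y; have : [set: G] y by []; rewrite -genS.
suff: generated S `<=` [set y | A [~ x, y]] by apply.
apply: sub_generated => [|{}y Sy]; last exact: AG.
apply/subgroupP; split => /=; first by rewrite commg1; exact: (subgroup1 sA).
move=> w z Aw Az; rewrite -invgR commMg commVg invgM invgK invgR -(invgR x z).
by apply: (subgroupM sA) => //; apply: (subgroupV sA).
Qed.

Lemma normalizes_comm (A : set G) x :
  subgroup A -> (forall y z, A [~ y, z]) -> normalizes A x.
Proof. by move=> sA AG a i Aa; rewrite conjg_comm; apply: subgroupM. Qed.

Lemma normalizes_central (A : set G) x : (forall y, commute x y) -> normalizes A x.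
Proof.
move=> cx a i Aa; have -> : a ^ expz x i = a; last by [].
apply/conjg_fixP/commgP; case: i => n /=; last apply: commuteV.
all: exact/commuteX/commute_sym.
Qed.

(* Adjoining first the commutators of the generators, which are central, makes
   every later generator normalize the subgroup reached so far. *)
Lemma adjoin_ind (A0 : set G) (P : set G -> Prop) :
  finitely_generated G -> subgroup A0 -> P A0 ->
  (forall A x, A0 `<=` A -> subgroup A -> normalizes A x -> P A -> P (adjoin A x)) ->
  P [set: G].
Proof.
move=> [S /finite_seqP[s ->] gens] sA0 PA0 step.
(* Adjoins the elements of [r] in turn. They must normalize every subgroup above [A], because [A]
   grows along the way. *)
have ext (r : seq G) A : A0 `<=` A -> subgroup A -> P A ->
    (forall x B, x \in r -> A `<=` B -> subgroup B -> normalizes B x) ->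
    exists B, [/\ A `<=` B, subgroup B, P B & forall x, x \in r -> B x].
  elim: r A => [|x r IH] A A0A sA PA nA; first by exists A; split.
  have nAx : normalizes A x by apply: nA => //; rewrite mem_head.
  have sAx := @sub_adjoin G A x.
  case: (IH (adjoin A x)) => [||||B [AB sB PB rB]].
  - exact: subset_trans sAx.
  - exact: subgroup_adjoin.
  - exact: step.
  - move=> y B yr AB; apply: nA; first by rewrite inE yr orbT.
    exact: subset_trans AB.
  exists B; split=> //; first exact: subset_trans AB.
  move=> y; rewrite inE => /orP[/eqP->|]; last exact: rB.
  by apply: AB; apply: mem_adjoin.
have [|B [A0B sB PB cB]] :=
    ext [seq [~ x, y] | x <- s, y <- s] _ (@subset_refl _ A0) sA0 PA0.
  move=> _ B /allpairsP[[x y] [_ _ ->]] _ _; apply: normalizes_central => z.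
  exact: nil2.
have {cB} cB : forall x y, B [~ x, y].
  by apply: comm_sub_generated gens _ _ => // x y xs ys; apply: cB; apply: allpairs_f.
have [|C [_ sC PC rC]] := ext s _ A0B sB PB.
  by move=> x C _ BC sC; apply: normalizes_comm => // y z; apply: BC.
suff -> : [set: G] = C by [].
by apply/seteqP; split=> //; rewrite -gens; apply: sub_generated.
Qed.

(** Either [x] has finite order modulo [A], or the exponent of [x] is determined by the element of
    [adjoin A x]. *)
Lemma adjoin_torsion_dichotomy (A : set G) x : subgroup A ->
  (exists2 p : nat, (0 < p)%N & A (x ^+ p)) \/
  (forall i, A (expz x i) -> i = 0%R).
Proof.
move=> sA; have [|nex] := pselect (exists2 p : nat, (0 < p)%N & A (x ^+ p)).
  by left.
right=> -[[|n]|n] //= An; case: nex; exists n.+1 => //.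
by rewrite -(invgK (x ^+ _)); apply: subgroupV.
Qed.

(** Since [x ^+ N] is in [K], adjoining [x] multiplies the number of cosets of [K] by at most
    [N]. *)
Lemma finite_index_of_powers (K : set G) N : finitely_generated G ->
  subgroup K -> (0 < N)%N -> (forall x, K (x ^+ N)) -> finite_index K [set: G].
Proof.
move=> fg sK N0 KN; split=> //.
apply: (@adjoin_ind K (fun A => finite_set [set [set k * x | k in K] | x in A])) => //.
  apply: (sub_finite_set _ (finite_set1 K)) => _ [x Kx <-] /=.
  apply/seteqP; split => [_ [k Kk <-]|y Ky]; first exact: subgroupM.
  by exists (y / x); [exact: subgroupF | rewrite mulgVK].
move=> A x KA sA nA finA.
have := finite_image2 (fun C r => [set c * x ^+ r | c in C]) finA (finite_II N).
apply: sub_finite_set => _ [_ [a [i [Aa ->]]] <-].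
have xN q : A (expz x (q * N%:Z)%R).
  by apply: KA; rewrite mulrC expzM; apply: subgroup_expz sK (KN x).
(* Write [i = q * N + r] with [0 <= r < N]: the part [a * expz x (q * N)] lies in [A], and [x ^+ r]
   takes at most [N] values. *)
exists [set k * (a * expz x (divz i N * N%:Z)%R) | k in K].
  by exists (a * expz x (divz i N * N%:Z)%R) => //; apply: subgroupM.
have N0' : (N%:Z != 0)%R by rewrite eqz_nat -lt0n.
exists (absz (modz i N)).
  by rewrite /= -ltz_nat gez0_abs ?modz_ge0 // ltz_mod.
have -> : expz x i = expz x (divz i N * N%:Z)%R * x ^+ absz (modz i N).
  rewrite {1}(divz_eq i N) expzD; congr (_ * _).
  by rewrite -[LHS]/(expz x (modz i N)) -{1}(gez0_abs (modz_ge0 i N0')).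
apply/seteqP; split => [_ [_ [k Kk <-] <-]|_ [k Kk <-]].
  by exists k; rewrite // !mulgA.
by exists (k * (a * expz x (divz i N * N%:Z)%R)); [exists k | rewrite !mulgA].
Qed.

(** Induction by adjoining [x] to [A]. If [x ^+ p] is in [A], then [u ^+ p] is divisible within [A],
    hence trivial, and torsion-freeness applies. Otherwise the exponent of [x] in [u] is divisible
    by every [m ^ k], so it vanishes, and so do those of the roots. *)
Lemma divisible_eq1 m u : finitely_generated G -> torsion_free G -> (1 < m)%N ->
  (forall k, exists v : G, v ^+ (m ^ k) = u) -> u = 1.
Proof.
move=> fg tf m1 divu.
suff : forall u, [set: G] u ->
    (forall k, exists2 v : G, [set: G] v & v ^+ (m ^ k) = u) -> u = 1.
  by apply=> // k; have [v] := divu k; exists v.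
clear u divu.
apply: (@adjoin_ind [set 1] (fun A => forall u, A u ->
    (forall k, exists2 v : G, A v & v ^+ (m ^ k) = u) -> u = 1)) => //.
  by apply/subgroupP; split=> // _ _ -> ->; rewrite mulgV.
move=> A x _ sA nA divA u Au divu.
have [[p p0 Axp]|xfree] := adjoin_torsion_dichotomy x sA.
  have Ap y : adjoin A x y -> A (y ^+ p).
    move=> [a [i [Aa ->]]]; have [b Ab ->] := adjoin_exp i p sA nA Aa.
    by apply: subgroupM => //; rewrite mulrC expzM; apply: subgroup_expz.
  apply: (tf u p p0); apply: divA; first exact: Ap.
  move=> k; have [v Av vu] := divu k.
  by exists (v ^+ p); [exact: Ap | rewrite -vu -!expgnA mulnC].
have coef a b i j : A a -> A b -> a * expz x i = b * expz x j -> i = j.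
  move=> Aa Ab E; apply/eqP; rewrite -subr_eq0; apply/eqP/xfree.
  have -> : expz x (i - j)%R = a^-1 * b.
    by apply: (mulgI a); rewrite expzD expzN mulgA E mulgK mulVKg.
  by apply: subgroupM => //; apply: subgroupV.
case: Au => a [i [Aa uE]].
have root k : exists b j,
    [/\ A b, (b * expz x j) ^+ (m ^ k) = u & i = (j * (m ^ k)%N%:Z)%R].
  have [_ [b [j [Ab ->]]] vu] := divu k.
  exists b, j; split=> //; have [d Ad E] := adjoin_exp j (m ^ k) sA nA Ab.
  by apply: (coef a d) => //; rewrite -E vu uE.
have i0 : i = 0%R.
  (* For this [k], [m ^ k] exceeds the absolute value of [i], so it divides [i] only if [i] is 0. *)
  have [b [j [_ _ ij]]] := root `|i|%N.
  apply/eqP; rewrite -absz_eq0; apply: contraT; rewrite -lt0n => ipos.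
  have := ltn_expl `|i|%N m1; rewrite {1}ij abszM ltnNge leq_pmull //.
  by rewrite lt0n; apply: contraTneq ipos => j0; rewrite ij abszM j0.
apply: divA; first by rewrite uE i0 mulg1.
move=> k; have [b [j [Ab vu ij]]] := root k; exists b => //.
suff j0 : j = 0%R by move: vu; rewrite j0 mulg1.
apply/eqP; move: ij; rewrite i0 => /esym/eqP; rewrite mulf_eq0 => /orP[//|].
by rewrite eqz_nat expn_eq0; case: (m) m1.
Qed.

End ClassTwo.

(** * Extending a quadratic map to an adjoined element *)

Section BiadditiveExtension.
Variables (G : groupType) (V : zmodType) (b : G -> G -> V).
Hypothesis b_mull : forall x y z, b (x * y) z = (b x z + b y z)%R.
Hypothesis b_mulr : forall x y z, b x (y * z) = (b x y + b x z)%R.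
Hypothesis b_alt : forall x, b x x = 0%R.

Definition quadratic_on (A : set G) (e : G -> V) :=
  forall x y, A x -> A y -> e (x * y) = (e x + e y + b x y)%R.

Lemma biadd1g x : b 1 x = 0%R.
Proof. by apply: (addrI (b 1 x)); rewrite -b_mull mul1g addr0. Qed.

Lemma biaddVg x y : b x^-1 y = (- b x y)%R.
Proof. by apply: (addrI (b x y)); rewrite -b_mull mulgV biadd1g subrr. Qed.

Lemma biaddg1 x : b x 1 = 0%R.
Proof. by apply: (addrI (b x 1)); rewrite -b_mulr mul1g addr0. Qed.

Lemma biaddgV x y : b x y^-1 = (- b x y)%R.
Proof. by apply: (addrI (b x y)); rewrite -b_mulr mulgV biaddg1 subrr. Qed.

Lemma biaddC x y : b x y = (- b y x)%R.
Proof.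
apply/eqP; rewrite -addr_eq0; apply/eqP.
by have := b_alt (x * y); rewrite b_mull !b_mulr !b_alt addr0 add0r.
Qed.

Lemma biaddXg x y n : b (x ^+ n) y = (b x y *+ n)%R.
Proof. by elim: n => [|n IH]; rewrite ?biadd1g // expgS b_mull IH mulrS. Qed.

Lemma biadd_expz x i j : b (expz x i) (expz x j) = 0%R.
Proof.
have b0 k y : b x y = 0%R -> b (expz x k) y = 0%R.
  by case: k => n xy /=; rewrite ?biaddVg biaddXg xy mul0rn ?oppr0.
by rewrite b0 // biaddC b0 ?oppr0 // b_alt.
Qed.

Lemma biadd_comm x y z : b [~ x, y] z = 0%R.
Proof. by rewrite /commg /conjg !b_mull !biaddVg (addrC (b x z)) addKr addNr. Qed.

Variables (A : set G) (x : G) (e : G -> V) (c : V).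
Hypothesis sA : subgroup A.
Hypothesis nA : normalizes A x.
Hypothesis e_quad : quadratic_on A e.
Hypothesis e_comm : forall y z, A [~ y, z] -> e [~ y, z] = (b y z *+ 2)%R.
Hypothesis e_pow : forall i, A (expz x i) -> e (expz x i) = (c *~ i)%R.

(** The value that the quadratic law forces on [a * expz x i] once [expz x i] is sent to [c *~ i];
    this linear rule is consistent because [b] vanishes on pairs of powers of [x]. *)
Let value a i := (e a + c *~ i + b a (expz x i))%R.

(** Two expressions of an element differ by a power of [x] lying in [A], where [e_pow] makes [e]
    follow the linear rule. *)
Lemma quad_value_uniq a a' i i' : A a -> A a' ->
  a * expz x i = a' * expz x i' -> value a i = value a' i'.
Proof.
move=> Aa Aa' E.
have Ed : expz x (i - i')%R = a^-1 * a'.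
  by apply: (mulgI a); rewrite expzD expzN mulgA E mulgK mulVKg.
have Ad : A (expz x (i - i')%R).
  by rewrite Ed; apply: (subgroupM sA) => //; apply: (subgroupV sA).
have -> : a' = a * expz x (i - i')%R by rewrite Ed mulVKg.
rewrite /value e_quad // e_pow // b_mull biadd_expz addr0 -{1 2}(subrK i' i).
move: (i - i')%R => d; rewrite expzD b_mulr mulrzDr !addrA; congr (_ + _)%R.
by rewrite addrAC.
Qed.

Lemma quad_conj h i : A h -> e (h ^ expz x i) = (e h + b h (expz x i) *+ 2)%R.
Proof.
move=> Ah; have Ac : A [~ h, expz x i].
  by rewrite commgEl; apply: (subgroupM sA); [apply: (subgroupV sA) | apply: nA].
have {1}-> : h ^ expz x i = h * [~ h, expz x i] by rewrite commgEl mulVKg.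
by rewrite e_quad // e_comm // (biaddC h [~ _, _]) biadd_comm oppr0 addr0.
Qed.

(** In a product, moving [expz x i] past [h] replaces [h] by a conjugate, whose value [quad_conj]
    supplies. *)
Lemma quad_adjoin : exists e1 : G -> V,
  quadratic_on (adjoin A x) e1 /\ forall a, A a -> e1 a = e a.
Proof.
pose rel y v := exists a i, [/\ A a, y = a * expz x i & v = value a i].
pose e1 y := xget 0%R [set v | rel y v].
have e1E a i : A a -> e1 (a * expz x i) = value a i.
  move=> Aa; have := @xgetPex _ 0%R [set v | rel (a * expz x i) v].
  case; first by exists (value a i), a, i.
  by move=> a' [i' [Aa' E e1E]]; rewrite /e1 e1E; apply/esym/quad_value_uniq.
exists e1; split; last first.
  move=> a Aa; have := e1E a 0%R Aa; rewrite /= mulg1 => ->.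
  by rewrite /value /= biaddg1 mulr0z !addr0.
move=> _ _ [g [i [Ag ->]]] [h [j [Ah ->]]].
rewrite adjoin_mul e1E; last by apply: (subgroupM sA) => //; apply: nA.
rewrite !e1E // /value e_quad //; last exact: nA.
rewrite quad_conj // expzD mulrzDr !(b_mulr, b_mull) !expzN !invgK !biaddgV.
rewrite (biaddC (expz x i) h) !biaddVg !biadd_expz !oppr0 !(addr0, add0r) mulNrn mulr2n opprD.
rewrite (addrC _ (_ - b g (expz x i))%R) subrK !addrA.
(* Conjugation contributes [- b h (expz x i)] twice: one copy cancels the cross term
   [b h (expz x i)], the other is [b (expz x i) h]. *)
by rewrite [LHS](ACl (1*6*8*2*7*11*5*3*10*(4*9))%AC) /= addNr addr0.
Qed.
End BiadditiveExtension.

(** * The centre as an additive group, and the quadratic map into it *)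

Section CenterModule.
Variable G : groupType.

(** Boolean, so that the centre becomes a subtype and can carry the additive structure required of
    [V]. *)
Definition central : pred G := fun x => `[< forall y, commute x y >].

Lemma centralP x : reflect (forall y, commute x y) (central x).
Proof. exact: asboolP. Qed.

Lemma central1 : central 1.
Proof. by apply/centralP => y; apply/commute_sym/commute1. Qed.

Lemma centralM x y : central x -> central y -> central (x * y).
Proof.
move=> /centralP cx /centralP cy; apply/centralP => z.
by apply/commute_sym/commuteM; apply/commute_sym.
Qed.

Lemma centralV x : central x -> central x^-1.
Proof.
by move=> /centralP cx; apply/centralP => z; apply/commute_sym/commuteV/commute_sym.
Qed.

Lemma subgroup_central : subgroup [set x | central x].
Proof.
apply/subgroupP; split=> [|x y]; first exact: central1.
by move=> /= cx cy; apply/centralM/centralV.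
Qed.

Lemma centralX x n : central x -> central (x ^+ n).
Proof. exact: (@subgroupX _ _ subgroup_central). Qed.

Definition center_type := {x : G | central x}.
HB.instance Definition _ := Choice.on center_type.

Implicit Types u v w : center_type.

Let zero : center_type := Sub 1 central1.
Let add u v : center_type := Sub (val u * val v) (centralM (valP u) (valP v)).
Let opp u : center_type := Sub (val u)^-1 (centralV (valP u)).

Let addA : associative add.
Proof. by move=> u v w; apply: val_inj; rewrite /= mulgA. Qed.
Let addC : commutative add.
Proof. by move=> u v; apply: val_inj; apply: (centralP _ (valP u)). Qed.
Let add0 : left_id zero add.
Proof. by move=> u; apply: val_inj; rewrite /= mul1g. Qed.
Let addN : left_inverse zero opp add.
Proof. by move=> u; apply: val_inj; rewrite /= mulVg. Qed.

HB.instance Definition _ := GRing.isZmodule.Build center_type addA addC add0 addN.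

Lemma val_centerD u v : val (u + v)%R = val u * val v.
Proof. by []. Qed.

Lemma val_centerMn u n : val (u *+ n)%R = val u ^+ n.
Proof. by elim: n => [//|n IH]; rewrite mulrS val_centerD IH expgS. Qed.

Definition to_center x : center_type := insubd zero x.

Lemma to_centerK x : central x -> val (to_center x) = x.
Proof. by move=> cx; rewrite insubdK. Qed.

Lemma to_centerM x y : central x -> central y ->
  to_center (x * y) = (to_center x + to_center y)%R.
Proof.
by move=> cx cy; apply: val_inj; rewrite val_centerD !to_centerK //; apply: centralM.
Qed.

Lemma to_center1 : to_center 1 = 0%R.
Proof. by apply: val_inj; rewrite to_centerK ?central1. Qed.

Hypothesis nil2 : class_le2 G.

Lemma central_comm x y : central [~ x, y].
Proof. by apply/centralP => z; apply: nil2. Qed.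

Definition comm_form x y := to_center [~ x, y].

Lemma comm_form_mull x y z : comm_form (x * y) z = (comm_form x z + comm_form y z)%R.
Proof. by rewrite /comm_form commMg // to_centerM //; apply: central_comm. Qed.

Lemma comm_form_mulr x y z : comm_form x (y * z) = (comm_form x y + comm_form x z)%R.
Proof. by rewrite /comm_form commgM // to_centerM //; apply: central_comm. Qed.

(* In the Malcev completion, with a complement to the centre of its Lie algebra
   chosen, [M]-fold twice the central coordinate of [log x] is such a map. *)
Lemma exists_quadratic : finitely_generated G ->
  exists (M : nat) (e : G -> center_type), [/\ (0 < M)%N,
    forall x y, e (x * y) = (e x + e y + comm_form x y *+ M)%R &
    forall z, central z -> e z = (to_center z *+ (2 * M))%R].
Proof.
move=> fg.
pose Q A M e := quadratic_on (fun x y => comm_form x y *+ M)%R A e /\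
  forall z, central z -> e z = (to_center z *+ (2 * M))%R.
pose P A := exists (M : nat) (e : G -> center_type), (0 < M)%N /\ Q A M e.
suff [M [e [M0 [qe ze]]]] : P [set: G].
  by exists M, e; split=> // x y; apply: qe.
apply: (adjoin_ind nil2 fg subgroup_central).
  exists 1%N, (fun z => to_center z *+ 2)%R; split=> //; split=> [x y cx cy|z _] //.
  rewrite to_centerM // mulrnDl; suff -> : comm_form x y = 0%R by rewrite mul0rn addr0.
  by rewrite /comm_form (eqP (introT commgP (centralP _ cx y))) to_center1.
move=> A x ZA sA nA [M [e [M0 [qe ze]]]].
have qeA y : A y -> forall n, e (y ^+ n) = (e y *+ n)%R.
  move=> Ay; elim=> [|n IH]; first by rewrite ze ?central1 // to_center1 mul0rn.
  rewrite expgS qe //; last exact: subgroupX.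
  by rewrite IH mulrS /comm_form commgXg to_center1 mul0rn addr0.
have e1 : e 1 = 0%R by rewrite ze ?central1 // to_center1 mul0rn.
have qeV y : A y -> e y^-1 = (- e y)%R.
  move=> Ay; apply: (addrI (e y)); rewrite subrr -[RHS]e1 -(mulgV y) qe //.
    by rewrite /comm_form commgVg to_center1 mul0rn addr0.
  exact: subgroupV.
have qeZ y i : A y -> e (expz y i) = (e y *~ i)%R.
  move=> Ay; case: i => n /=; first exact: qeA.
  by rewrite qeV ?qeA //; apply: subgroupX.
(* [c] is to be the value at [x] of the extension of [k] times [e]. If [x ^+ p] is in [A], then [p]
   times [e (expz x i)] is [i] times [e (x ^+ p)]; otherwise only [i = 0] occurs and any [c] would
   do. *)
have [k [c [k0 ck]]] : exists (k : nat) (c : center_type), (0 < k)%N /\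
    forall i, A (expz x i) -> (e (expz x i) *+ k = c *~ i)%R.
  have [[p p0 Axp]|xfree] := adjoin_torsion_dichotomy x sA.
    exists p, (e (x ^+ p)); split=> // i Axi.
    rewrite -qeA // -[_ ^+ p]/(expz _ p) -expzM mulrC expzM qeZ //.
  by exists 1%N, 0%R; split=> // i /xfree ->; rewrite /= e1 mul0rn mulr0z.
have kM0 : (0 < M * k)%N by rewrite muln_gt0 M0.
have [||||||e' [qe' ee']] := @quad_adjoin G center_type
  (fun y z => comm_form y z *+ (M * k))%R _ _ _ A x (fun y => e y *+ k)%R c sA nA.
- by move=> y z w; rewrite comm_form_mull mulrnDl.
- by move=> y z w; rewrite comm_form_mulr mulrnDl.
- by move=> y; rewrite /comm_form commgg to_center1 mul0rn.
- by move=> y z Ay Az; rewrite qe // !mulrnDl mulrnA.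
(* The factor [2 * M] prescribed on the centre is what the compatibility with commutators
   demands. *)
- move=> y z _; rewrite ze ?central_comm // -!mulrnA; congr (_ *+ _)%R.
  by rewrite -mulnA mulnC.
- exact: ck.
exists (M * k)%N, e'; split=> //; split=> // z cz.
by rewrite ee' ?ze ?mulnA ?mulrnA //; apply: ZA.
Qed.
End CenterModule.

(** * Finite index and powers of products *)

Lemma finite_index_powers (G : groupType) (H : set G) : finite_index H [set: G] ->
  exists2 N, (0 < N)%N & forall x, H (x ^+ N).
Proof.
(* By pigeonhole some [x ^+ (j - i)] with [0 < j - i <= size s] lies in [H], and the factorial is a
   multiple of every such difference. *)
move=> [sH _ /finite_seqP[s sE]]; exists (size s)`!; first exact: fact_gt0.
move=> x; pose coset i := [set k * x ^+ i | k in H].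
pose t := [seq coset i | i <- iota 0 (size s).+1].
have tsz : size t = (size s).+1 by rewrite size_map size_iota.
have : ~~ uniq t.
  apply: contraT; rewrite negbK => /uniq_leq_size ts.
  have : (size t <= size s)%N.
    apply: ts => _ /mapP[i _ ->].
    by suff : [set` s] (coset i) by []; rewrite -sE; exists (x ^+ i).
  by rewrite tsz ltnn.
case/(uniqPn set0) => i [j [ij jt]]; rewrite tsz in jt.
have it := ltn_trans ij jt.
rewrite !(nth_map 0%N) ?size_iota // !nth_iota // !add0n => E.
have : coset j (x ^+ j) by exists 1; rewrite ?mul1g //; apply: subgroup1.
rewrite -E => -[k Hk kx].
have Hij : H (x ^+ (j - i)) by rewrite expgnFr ?(ltnW ij) // -kx mulgK.
have /dvdnP[q ->] : (j - i %| (size s)`!)%N.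
  by rewrite dvdn_fact // subn_gt0 ij; apply: leq_trans (leq_subr _ _) _.
by rewrite mulnC expgnA; apply: subgroupX.
Qed.

Lemma finite_index_sub (G : groupType) (K H : set G) :
  finite_index K [set: G] -> K `<=` H -> finite_index K H.
Proof.
move=> [sK _ finK] KH; split=> //; apply: sub_finite_set finK.
by apply: image_subset.
Qed.

Lemma subgroup_range (G : groupType) (phi : G -> G) :
  {morph phi : x y / x * y} -> subgroup (range phi).
Proof.
move=> phiM; have phi1 : phi 1 = 1 by apply: (mulgI (phi 1)); rewrite -phiM !mulg1.
apply/subgroupP; split; first by exists 1.
move=> _ _ [x _ <-] [y _ <-]; exists (x / y) => //.
by apply: (mulIg (phi y)); rewrite -phiM !mulgVK.
Qed.

(** Moving the last [x] to the left past [y ^+ n] creates [n] further factors [[~ y, x]], in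
    accordance with Pascal's rule. *)
Lemma expMg_class2 (G : groupType) (x y : G) n : class_le2 G ->
  (x * y) ^+ n = x ^+ n * y ^+ n * [~ y, x] ^+ 'C(n, 2).
Proof.
move=> nil2; elim: n => [|n IH]; first by rewrite !mulg1.
have cz z : commute z ([~ y, x] ^+ 'C(n, 2)) by apply/commuteX/commute_sym/nil2.
rewrite expgSr IH -mulgA -cz !mulgA -(mulgA (x ^+ n)) (commgC (y ^+ n) x) commXg //.
rewrite binS bin1 addnC expgnDr !mulgA -expgSr; congr (_ * _).
have cn z : commute z ([~ y, x] ^+ n) by apply/commuteX/commute_sym/nil2.
by rewrite -(mulgA _ (_ ^+ n) y) -cn !mulgA -(mulgA _ (y ^+ n)) -expgSr.
Qed.

(** * Dilations and their inverses *)

Section Dilation.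
Variables (G : groupType) (phi : G -> G) (n : nat).
Implicit Types (x y z u v : G) (k : nat).
Hypothesis fgG : finitely_generated G.
Hypothesis tfG : torsion_free G.
Hypothesis nil2 : class_le2 G.
Hypothesis n_gt1 : (1 < n)%N.
Hypothesis phiM : {morph phi : x y / x * y}.
Hypothesis phi_central : forall z, central z -> phi z = z ^+ (n * n).
Hypothesis phi_mod : forall x, exists2 z, central z & phi x = x ^+ n * z.

(** [[~ x, y] ^+ m = [~ x ^+ m, y]] is trivial, so torsion-freeness kills [[~ x, y]]. *)
Lemma central_of_power x m : (0 < m)%N -> central (x ^+ m) -> central x.
Proof.
move=> m0 /centralP cx; apply/centralP => y; apply/commgP/eqP/(tfG m0).
by rewrite -commXg //; apply/eqP/commgP.
Qed.

Lemma comm_centralr x y z : central z -> [~ x * z, y] = [~ x, y].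
Proof.
by move=> /centralP cz; rewrite commMg // (_ : [~ z, y] = 1) ?mulg1 //; apply/eqP/commgP.
Qed.

Lemma dilation_central x : central (phi x) -> central x.
Proof.
have [z cz ->] := phi_mod x => cxz; apply: (@central_of_power x n); first exact: ltnW.
by rewrite -(mulgK z (x ^+ n)); apply/centralM/centralV.
Qed.

(** An element of the kernel has central image, so it is central; there [phi] is a power map,
    injective by torsion-freeness. *)
Lemma dilation_inj : injective phi.
Proof.
have phi1 : phi 1 = 1 by apply: (mulgI (phi 1)); rewrite -phiM !mulg1.
move=> x y E; apply: divg1_eq.
have Exy : phi (x / y) = 1 by apply: (mulIg (phi y)); rewrite -phiM mulgVK mul1g.
have cxy : central (x / y) by apply: dilation_central; rewrite Exy; apply: central1.
apply: (tfG (n := (n * n)%N)); first by rewrite muln_gt0 ltnW.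
by rewrite -phi_central.
Qed.

(** If [phi x = x ^+ n * z], raising to the power [n * n] leaves the excess factor [z ^+ (n * n)],
    which is [phi z]. *)
Lemma dilation_powers x : range phi (x ^+ (n * (n * n))).
Proof.
have sK := subgroup_range phiM; have [z cz E] := phi_mod x.
have -> : x ^+ (n * (n * n)) = phi x ^+ (n * n) * (phi z)^-1.
  rewrite E phi_central // expgMn ?mulgK -?expgnA //.
  by apply/commute_sym/centralP.
by apply: subgroupF => //; apply: subgroupX => //; exists x.
Qed.

Lemma dilation_finite_index : finite_index (range phi) [set: G].
Proof.
apply: (finite_index_of_powers nil2 fgG (subgroup_range phiM) _ dilation_powers).
by rewrite !muln_gt0 ltnW.
Qed.

(* If [u = phi^k (v)] for every [k] then the commutators of [u] are [n^k]-th
   powers for every [k], so [u] is central, and then [u] is an [n^(2k)]-th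
   power for every [k]. *)
Lemma dilation_divisible_eq1 u : (forall k, exists v, iter k phi v = u) -> u = 1.
Proof.
move=> divu.
have itermod k v : exists2 z, central z & iter k phi v = v ^+ (n ^ k) * z.
  elim: k => [|k [z cz IH]]; first by exists 1; rewrite ?mulg1 //; apply: central1.
  have [w cw] := phi_mod (v ^+ (n ^ k) * z).
  rewrite expgMn -?expgnA; last by apply/commute_sym/centralP.
  rewrite -mulgA /= IH => ->; exists (z ^+ n * w); last by rewrite -expnSr.
  apply: centralM => //; exact: centralX.
have cu : central u.
  apply/centralP => y; apply/commgP/eqP/(divisible_eq1 nil2 fgG tfG n_gt1) => k.
  have [v <-] := divu k; have [z cz ->] := itermod k v.
  by exists [~ v, y]; rewrite comm_centralr // commXg.
apply: (divisible_eq1 nil2 fgG tfG n_gt1) => k; have [v vu] := divu k.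
have cv : central v.
  have [z cz E] := itermod k v; apply: (@central_of_power v (n ^ k)).
    by rewrite expn_gt0 ltnW.
  rewrite -(mulgK z (v ^+ _)) -E vu; exact/centralM/centralV.
(* For central [v] the [k]-th iterate is the power [n ^ (2 * k)], that is, the [n ^ k]-th power of
   this witness. *)
exists (v ^+ (n ^ k)); rewrite -vu -expgnA.
elim: {vu} k => [//|k IH].
rewrite /= -IH phi_central; last exact: centralX.
by rewrite -expgnA !expnS; congr (_ ^+ _); rewrite mulnACA mulnC.
Qed.

Lemma dilation_strongly_simple : exists f,
  epimorphism_on (range phi) f /\ strongly_simple (range phi) f.
Proof.
pose f y := xget 1 [set x | phi x = y].
have fK x : f (phi x) = x.
  by apply: dilation_inj; apply: (@xgetPex _ 1 [set t | phi t = phi x]); exists x.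
exists f; split; first split.
- move=> _ _ /set_mem[x _ <-] /set_mem[y _ <-].
  by rewrite -phiM !fK.
- by apply/seteqP; split=> // x _; exists (phi x); [exists x | exact: fK].
move=> U [sU UK fU]; apply/seteqP; split=> [u Uu|_ ->]; last exact: subgroup1.
apply: dilation_divisible_eq1 => k.
(* Keeping [v] in [U] carries the induction: [v] is [phi w], and [w = f v] is again in [U] by
   invariance. *)
suff [v _ vu] : exists2 v, U v & iter k phi v = u by exists v.
elim: k => [|k [v Uv vu]]; first by exists u.
have [w _ wv] := UK v Uv; exists w; last by rewrite iterSr wv.
by apply: fU; exists v => //; rewrite -wv fK.
Qed.
End Dilation.

(** * Construction of the dilation, and the conclusion *)

Lemma exists_dilation (G : groupType) N : finitely_generated G -> class_le2 G ->
  (0 < N)%N -> exists (n : nat) (phi : G -> G), [/\ (1 < n)%N,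
    {morph phi : x y / x * y},
    (forall z, central z -> phi z = z ^+ (n * n)),
    (forall x, exists2 z, central z & phi x = x ^+ n * z) &
    (forall H : set G, subgroup H -> (forall x, H (x ^+ N)) -> range phi `<=` H)].
Proof.
move=> fg nil2 N0; have [M [e [M0 eM eZ]]] := exists_quadratic nil2 fg.
(* Both [n] and [t] are multiples of [N], which puts the image in [H]. Moreover [M * t] is
   ['C(n, 2)], and on the centre the exponent [n + 2 * M * t] equals [n * n]. *)
pose n := (2 * (M * N))%N; pose t := (N * n.-1)%N.
have n_gt1 : (1 < n)%N by rewrite /n mul2n -addnn -addn1 leq_add ?muln_gt0 ?M0.
have Mt : 'C(n, 2) = (M * t)%N.
  by rewrite bin2 {1}/n -mulnA mul2n doubleK /t mulnA.
have ct x : central (val (e x *+ t)%R) by apply: valP.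
exists n, (fun x => x ^+ n * val (e x *+ t)%R); split=> //.
- move=> x y; rewrite expMg_class2 // eM !mulrnDl !val_centerD Mt.
  have -> : val (comm_form x y *+ M *+ t)%R = [~ x, y] ^+ (M * t).
    by rewrite -mulrnA val_centerMn to_centerK //; apply: central_comm.
  (* The factor [[~ x, y] ^+ (M * t)] from the quadratic law cancels the [[~ y, x] ^+ (M * t)] from
     the power of the product. *)
  rewrite (centralP _ (centralM (ct x) (ct y)) ([~ x, y] ^+ _)).
  rewrite -invgR expVgn !mulgA mulgVK -!mulgA; congr (_ * _).
  by rewrite !mulgA; congr (_ * _); rewrite (centralP _ (ct x)).
- move=> z cz; rewrite eZ // -mulrnA val_centerMn to_centerK // -expgnDr.
  congr (_ ^+ _); rewrite /t mulnA -(mulnA 2) -/n -{1}(muln1 n) -mulnDr add1n.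
  by rewrite prednK // ltnW.
- by move=> x; exists (val (e x *+ t)%R).
move=> H sH HN _ [x _ <-]; apply: subgroupM => //.
  by rewrite /n mulnA mulnC expgnA; apply: subgroupX.
by rewrite val_centerMn /t expgnA; apply: subgroupX.
Qed.

Theorem theorem2 (G : groupType) (c : nat) (H : set G)
    (fgG : finitely_generated G) (tfG : torsion_free G)
    (nilG : nilpotent_of_class G c) (c_le2 : (c <= 2)%N)
    (finH : finite_index H [set: G]) :
  exists (K : set G) (f : G -> G),
    [/\ finite_index K H, epimorphism_on K f & strongly_simple K f].
Proof.
have nil2 := nilpotent_class_le2 nilG c_le2.
have [N N0 HN] := finite_index_powers finH; have [sH _ _] := finH.
have [n [phi [n1 phiM phiZ phimod phiH]]] := exists_dilation fgG nil2 N0.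
have [f [epif simf]] := dilation_strongly_simple fgG tfG nil2 n1 phiM phiZ phimod.
exists (range phi), f; split=> //; apply: finite_index_sub; last exact: phiH.
exact: dilation_finite_index n1 phiM phiZ phimod.
Qed.
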